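(* Let $A$ be a Frobenius algebra in a monoidal category $\mathcal{C}$ and let $(\nu,e)$ be a Frobenius pair for $A$. Then $A$ is separable if and only if there exists a morphism $\alpha:\underline{1}\to A$ in $\mathcal{C}$ such that $$m_A(m_A\otimes\mathrm{Id}_A)(\mathrm{Id}_A\otimes\alpha\otimes\mathrm{Id}_A)e=\eta_A.$$
   Context: Monoidal categories are taken strict, with tensor product $\otimes$ and unit object $\underline{1}$; $m_A,\eta_A$ denote multiplication and unit of an algebra $A$. An algebra $A$ is Frobenius if it has a Frobenius pair, i.e. a pair $(\nu,e)$ of morphisms $\nu:A\to\underline{1}$, $e:\underline{1}\to A\otimes A$ with $(m_A\otimes\mathrm{Id}_A)(\mathrm{Id}_A\otimes e)=(\mathrm{Id}_A\otimes m_A)(e\otimes\mathrm{Id}_A)$ and $(\nu\otimes\mathrm{Id}_A)e=\eta_A=(\mathrm{Id}_A\otimes\nu)e$. An algebra $A$ is separable if there is an $A$-bimodule morphism $\gamma:A\to A\otimes A$ (bimodule structures via $m_A$) with $m_A\gamma=\mathrm{Id}_A$. *)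

(* Defs.v *)
From mathcomp Require Import ssreflect ssrfun ssrbool.
From Stdlib Require Import Eqdep.

Set Implicit Arguments.
Unset Strict Implicit.
Unset Printing Implicit Defensive.

Declare Scope cat_scope.
Delimit Scope cat_scope with C.
Local Open Scope cat_scope.

Record category := Category {
  obj :> Type;
  hom : obj -> obj -> Type;
  idm : forall X, hom X X;
  comp : forall X Y Z, hom Y Z -> hom X Y -> hom X Z;
  comp1m : forall X Y (f : hom X Y), comp (idm Y) f = f;
  compm1 : forall X Y (f : hom X Y), comp f (idm X) = f;
  compA : forall W X Y Z (h : hom Y Z) (g : hom X Y) (f : hom W X),
    comp h (comp g f) = comp (comp h g) f
}.

Arguments idm {c} X.
Arguments comp {c X Y Z} g f.

Notation "g ∘ f" := (comp g f) (at level 40, left associativity) : cat_scope.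

(* The identity morphism of X, with its target rewritten along X = Y. In a
   strict monoidal category, objects such as X ⊗ (Y ⊗ Z) and (X ⊗ Y) ⊗ Z are
   equal but not convertible; eqm is the identity that is left implicit on
   paper when composing through such an equality. *)
Definition eqm (C : category) (X Y : C) (e : X = Y) : hom X Y :=
  match e in _ = Y' return hom X Y' with erefl => idm X end.

(* The last three axioms say that the tensor product of morphisms is strictly
   associative and unital: (f ⊗ g) ⊗ h = f ⊗ (g ⊗ h), f ⊗ Id = f and
   Id ⊗ f = f, modulo the identifications of their sources and targets given
   by the object equalities. *)
Record strictMonoidal := StrictMonoidal {
  cat :> category;
  munit : cat;
  tens : cat -> cat -> cat;
  tensm : forall X X' Y Y' : cat,
    hom X X' -> hom Y Y' -> hom (tens X Y) (tens X' Y');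
  tensm1 : forall X Y : cat, tensm (idm X) (idm Y) = idm (tens X Y);
  tensm_comp : forall (X X' X'' Y Y' Y'' : cat)
    (f' : hom X' X'') (f : hom X X') (g' : hom Y' Y'') (g : hom Y Y'),
    tensm (f' ∘ f) (g' ∘ g) = tensm f' g' ∘ tensm f g;
  tensA : forall X Y Z : cat, tens X (tens Y Z) = tens (tens X Y) Z;
  tens_r1 : forall X : cat, tens X munit = X;
  tens_l1 : forall X : cat, tens munit X = X;
  tensmA : forall (X X' Y Y' Z Z' : cat)
    (f : hom X X') (g : hom Y Y') (h : hom Z Z'),
    tensm (tensm f g) h ∘ eqm (tensA X Y Z) =
    eqm (tensA X' Y' Z') ∘ tensm f (tensm g h);
  tensm_r1 : forall (X X' : cat) (f : hom X X'),
    f ∘ eqm (tens_r1 X) = eqm (tens_r1 X') ∘ tensm f (idm munit);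
  tensm_l1 : forall (X X' : cat) (f : hom X X'),
    f ∘ eqm (tens_l1 X) = eqm (tens_l1 X') ∘ tensm (idm munit) f
}.

Arguments munit {s}.
Arguments tens {s} X Y.
Arguments tensm {s X X' Y Y'} f g.

Notation "𝟙" := munit : cat_scope.
Notation "X ⊗ Y" := (tens X Y) (at level 38, left associativity) : cat_scope.
Notation "f ⊗ₘ g" := (tensm f g) (at level 38, left associativity) : cat_scope.

(* All of these are identity morphisms, as the category is strict. *)
Definition assoc (C : strictMonoidal) (X Y Z : C) :
  hom (X ⊗ (Y ⊗ Z)) ((X ⊗ Y) ⊗ Z) := eqm (tensA X Y Z).
Definition assocV (C : strictMonoidal) (X Y Z : C) :
  hom ((X ⊗ Y) ⊗ Z) (X ⊗ (Y ⊗ Z)) := eqm (esym (tensA X Y Z)).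
Definition runit (C : strictMonoidal) (X : C) : hom (X ⊗ 𝟙) X :=
  eqm (tens_r1 X).
Definition runitV (C : strictMonoidal) (X : C) : hom X (X ⊗ 𝟙) :=
  eqm (esym (tens_r1 X)).
Definition lunit (C : strictMonoidal) (X : C) : hom (𝟙 ⊗ X) X :=
  eqm (tens_l1 X).
Definition lunitV (C : strictMonoidal) (X : C) : hom X (𝟙 ⊗ X) :=
  eqm (esym (tens_l1 X)).

Record algebra (C : strictMonoidal) := Algebra {
  alg :> C;
  mul : hom (alg ⊗ alg) alg;
  one : hom 𝟙 alg;
  mul_assoc : mul ∘ (mul ⊗ₘ idm alg) ∘ assoc alg alg alg =
    mul ∘ (idm alg ⊗ₘ mul);
  mul_1l : mul ∘ (one ⊗ₘ idm alg) ∘ lunitV alg = idm alg;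
  mul_1r : mul ∘ (idm alg ⊗ₘ one) ∘ runitV alg = idm alg
}.

Arguments mul {C} a.
Arguments one {C} a.

Record bimodule (C : strictMonoidal) (A : algebra C) := Bimodule {
  bim :> C;
  lact : hom (A ⊗ bim) bim;
  ract : hom (bim ⊗ A) bim;
  lact_mul : lact ∘ (mul A ⊗ₘ idm bim) ∘ assoc A A bim =
    lact ∘ (idm A ⊗ₘ lact);
  lact_one : lact ∘ (one A ⊗ₘ idm bim) ∘ lunitV bim = idm bim;
  ract_mul : ract ∘ (ract ⊗ₘ idm A) ∘ assoc bim A A =
    ract ∘ (idm bim ⊗ₘ mul A);
  ract_one : ract ∘ (idm bim ⊗ₘ one A) ∘ runitV bim = idm bim;
  lract : ract ∘ (lact ⊗ₘ idm A) ∘ assoc A bim A =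
    lact ∘ (idm A ⊗ₘ ract)
}.

Arguments lact {C A} b.
Arguments ract {C A} b.

Definition bimodule_morphism (C : strictMonoidal) (A : algebra C)
    (X Y : bimodule A) (f : hom X Y) : Prop :=
  f ∘ lact X = lact Y ∘ (idm A ⊗ₘ f) /\
  f ∘ ract X = ract Y ∘ (f ⊗ₘ idm A).

Definition regular_bimodule (C : strictMonoidal) (A : algebra C) :
    bimodule A :=
  @Bimodule C A A (mul A) (mul A) (mul_assoc A) (mul_1l A)
    (mul_assoc A) (mul_1r A) (mul_assoc A).

Section Coherence.
Variable C : strictMonoidal.

Lemma eqm_comp (X Y Z : C) (p : Y = Z) (q : X = Y) :
  eqm p ∘ eqm q = eqm (etrans q p).
Proof. by case: Z / p; rewrite /= comp1m. Qed.

Lemma eqm_irr (X Y : C) (p q : X = Y) : eqm p = eqm q.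
Proof. by rewrite (UIP _ _ _ p q). Qed.

Lemma eqm_tens (X X' Y Y' : C) (p : X = X') (q : Y = Y') :
  eqm p ⊗ₘ eqm q = eqm (f_equal2 tens p q).
Proof.
case: X' / p; case: Y' / q; rewrite /= tensm1.
exact: (eqm_irr erefl).
Qed.

Lemma eqm_tens1 (X Y Y' : C) (q : Y = Y') :
  idm X ⊗ₘ eqm q = eqm (f_equal2 tens (erefl X) q).
Proof. exact (eqm_tens (erefl X) q). Qed.

Lemma eqm_1tens (X X' Y : C) (p : X = X') :
  eqm p ⊗ₘ idm Y = eqm (f_equal2 tens p (erefl Y)).
Proof. exact (eqm_tens p (erefl Y)). Qed.

Lemma eqmK (X Y : C) (p : X = Y) (q : Y = X) : eqm q ∘ eqm p = idm X.
Proof. by rewrite eqm_comp (eqm_irr _ erefl). Qed.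

Lemma tensm_compl (X X' X'' Y : C) (f' : hom X' X'') (f : hom X X') :
  (f' ∘ f) ⊗ₘ idm Y = (f' ⊗ₘ idm Y) ∘ (f ⊗ₘ idm Y).
Proof. by rewrite -tensm_comp comp1m. Qed.

Lemma tensm_compr (X Y Y' Y'' : C) (g' : hom Y' Y'') (g : hom Y Y') :
  idm X ⊗ₘ (g' ∘ g) = (idm X ⊗ₘ g') ∘ (idm X ⊗ₘ g).
Proof. by rewrite -tensm_comp comp1m. Qed.

Lemma tensm_exch (X X' Y Y' : C) (f : hom X X') (g : hom Y Y') :
  (f ⊗ₘ idm Y') ∘ (idm X ⊗ₘ g) = (idm X' ⊗ₘ g) ∘ (f ⊗ₘ idm Y).
Proof. by rewrite -!tensm_comp !comp1m !compm1. Qed.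

Lemma tensmAV (X X' Y Y' Z Z' : C)
    (f : hom X X') (g : hom Y Y') (h : hom Z Z') :
  (f ⊗ₘ (g ⊗ₘ h)) ∘ assocV X Y Z = assocV X' Y' Z' ∘ ((f ⊗ₘ g) ⊗ₘ h).
Proof.
rewrite -[RHS]compm1 -(eqmK (esym (tensA X Y Z)) (tensA X Y Z)) compA.
by rewrite -(compA _ _ (eqm (tensA _ _ _))) tensmA !compA eqmK comp1m.
Qed.

Lemma tensm_r1V (X X' : C) (f : hom X X') :
  (f ⊗ₘ idm 𝟙) ∘ runitV X = runitV X' ∘ f.
Proof.
rewrite -[RHS]compm1 -(eqmK (esym (tens_r1 X)) (tens_r1 X)) compA.
by rewrite -(compA _ f) tensm_r1 !compA eqmK comp1m.
Qed.

Lemma tensm_l1V (X X' : C) (f : hom X X') :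
  (idm 𝟙 ⊗ₘ f) ∘ lunitV X = lunitV X' ∘ f.
Proof.
rewrite -[RHS]compm1 -(eqmK (esym (tens_l1 X)) (tens_l1 X)) compA.
by rewrite -(compA _ f) tensm_l1 !compA eqmK comp1m.
Qed.

End Coherence.

Section TensorBimodule.
Variables (C : strictMonoidal) (A : algebra C).

Definition tensor_lact : hom (A ⊗ (A ⊗ A)) (A ⊗ A) :=
  (mul A ⊗ₘ idm A) ∘ assoc A A A.
Definition tensor_ract : hom ((A ⊗ A) ⊗ A) (A ⊗ A) :=
  (idm A ⊗ₘ mul A) ∘ assocV A A A.

Lemma tensor_lact_mul :
  tensor_lact ∘ (mul A ⊗ₘ idm (A ⊗ A)) ∘ assoc A A (A ⊗ A) =
  tensor_lact ∘ (idm A ⊗ₘ tensor_lact).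
Proof.
rewrite /tensor_lact -(tensm1 A A) tensm_compr !compA.
rewrite -(compA (mul A ⊗ₘ idm A) (assoc A A A)) -tensmA !compA.
rewrite -(compA (mul A ⊗ₘ idm A) (assoc A A A)) -tensmA !compA.
rewrite -!tensm_compl -mul_assoc !tensm_compl -!compA; congr (_ ∘ (_ ∘ _)).
by rewrite /assoc eqm_1tens eqm_tens1 !eqm_comp; apply: eqm_irr.
Qed.

Lemma tensor_lact_one :
  tensor_lact ∘ (one A ⊗ₘ idm (A ⊗ A)) ∘ lunitV (A ⊗ A) = idm (A ⊗ A).
Proof.
rewrite /tensor_lact -(tensm1 A A).
rewrite -(compA (mul A ⊗ₘ idm A) (assoc A A A)) -tensmA !compA.
have -> : idm A ⊗ₘ idm A = (mul A ∘ (one A ⊗ₘ idm A) ∘ lunitV A) ⊗ₘ idm A.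
  by rewrite mul_1l.
rewrite !tensm_compl -!compA; congr (_ ∘ (_ ∘ _)).
by rewrite /lunitV eqm_1tens eqm_comp; apply: eqm_irr.
Qed.

Lemma tensor_ract_mul :
  tensor_ract ∘ (tensor_ract ⊗ₘ idm A) ∘ assoc (A ⊗ A) A A =
  tensor_ract ∘ (idm (A ⊗ A) ⊗ₘ mul A).
Proof.
rewrite /tensor_ract -(tensm1 A A) tensm_compl !compA.
rewrite -(compA (idm A ⊗ₘ mul A) (assocV A A A)) -tensmAV !compA.
rewrite -(compA (idm A ⊗ₘ mul A) (assocV A A A)) -tensmAV !compA.
rewrite -!tensm_compr -mul_assoc !tensm_compr -!compA; congr (_ ∘ (_ ∘ _)).
by rewrite /assoc /assocV eqm_1tens eqm_tens1 !eqm_comp; apply: eqm_irr.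
Qed.

Lemma tensor_ract_one :
  tensor_ract ∘ (idm (A ⊗ A) ⊗ₘ one A) ∘ runitV (A ⊗ A) = idm (A ⊗ A).
Proof.
rewrite /tensor_ract -(tensm1 A A).
rewrite -(compA (idm A ⊗ₘ mul A) (assocV A A A)) -tensmAV !compA.
have -> : idm A ⊗ₘ idm A = idm A ⊗ₘ (mul A ∘ (idm A ⊗ₘ one A) ∘ runitV A).
  by rewrite mul_1r.
rewrite !tensm_compr -!compA; congr (_ ∘ (_ ∘ _)).
by rewrite /runitV eqm_tens1 eqm_comp; apply: eqm_irr.
Qed.

Lemma tensor_lract :
  tensor_ract ∘ (tensor_lact ⊗ₘ idm A) ∘ assoc A (A ⊗ A) A =
  tensor_lact ∘ (idm A ⊗ₘ tensor_ract).
Proof.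
rewrite /tensor_ract /tensor_lact tensm_compl tensm_compr !compA.
rewrite -(compA (idm A ⊗ₘ mul A) (assocV A A A)) -tensmAV !compA.
rewrite -(compA (mul A ⊗ₘ idm A) (assoc A A A)) -tensmA !compA.
rewrite !tensm1 tensm_exch -!compA; congr (_ ∘ (_ ∘ _)).
by rewrite /assoc /assocV eqm_1tens eqm_tens1 !eqm_comp; apply: eqm_irr.
Qed.

Definition tensor_bimodule : bimodule A :=
  Bimodule tensor_lact_mul tensor_lact_one tensor_ract_mul tensor_ract_one
    tensor_lract.

End TensorBimodule.

Definition frobenius_pair (C : strictMonoidal) (A : algebra C)
    (nu : hom A 𝟙) (e : hom 𝟙 (A ⊗ A)) : Prop :=
  [/\ (mul A ⊗ₘ idm A) ∘ assoc A A A ∘ (idm A ⊗ₘ e) ∘ runitV A =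
      (idm A ⊗ₘ mul A) ∘ assocV A A A ∘ (e ⊗ₘ idm A) ∘ lunitV A,
      lunit A ∘ (nu ⊗ₘ idm A) ∘ e = one A
    & runit A ∘ (idm A ⊗ₘ nu) ∘ e = one A].

Definition frobenius (C : strictMonoidal) (A : algebra C) : Prop :=
  exists (nu : hom A 𝟙) (e : hom 𝟙 (A ⊗ A)), frobenius_pair nu e.

Definition separable (C : strictMonoidal) (A : algebra C) : Prop :=
  exists gamma : hom (regular_bimodule A) (tensor_bimodule A),
    bimodule_morphism gamma /\ mul A ∘ gamma = idm A.

(* Main.v *)
From mathcomp Require Import ssreflect ssrfun ssrbool.
Require Import Defs.

Local Open Scope cat_scope.

(** Write e = e1 ⊗ e2, so that x e1 ⊗ e2 = e1 ⊗ e2 x. Given alpha, the morphism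
    x |-> x e1 alpha ⊗ e2 is a bimodule section of the multiplication.
    Conversely, from a section gamma with gamma(1) = a ⊗ b take
    alpha = a nu(b). Then e1 alpha e2 = e1 a nu(b) e2 = a nu(b e1) e2 by the
    bilinearity of gamma, and nu(b e1) e2 = nu(e1) e2 b = b, which leaves
    a b = 1. *)

(** Associativity of the action: [f] is [x |-> x u], and [(x y) u = x (y u)]. It serves for [alpha]
    in [A] and for [e] in [A ⊗ A]. *)
Lemma lact_linear (C : strictMonoidal) (A : algebra C) (M : bimodule A)
    (u : hom 𝟙 M) (f := lact M ∘ (idm A ⊗ₘ u) ∘ runitV A) :
  f ∘ mul A = lact M ∘ (idm A ⊗ₘ f).
Proof.
rewrite /f !tensm_compr !compA -lact_mul.
rewrite -(compA _ (runitV A)) -tensm_r1V compA.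
rewrite -(compA _ (idm A ⊗ₘ u)) -tensm_exch !compA.
rewrite -(compA _ (assoc A A M)) -tensmA tensm1 -!compA.
congr (_ ∘ (_ ∘ (_ ∘ _))).
by rewrite /assoc /runitV eqm_tens1 eqm_comp; apply: eqm_irr.
Qed.

Lemma ract_linear (C : strictMonoidal) (A : algebra C) (M : bimodule A)
    (u : hom 𝟙 M) (f := ract M ∘ (u ⊗ₘ idm A) ∘ lunitV A) :
  f ∘ mul A = ract M ∘ (f ⊗ₘ idm A).
Proof.
have ractV : ract M ∘ (ract M ⊗ₘ idm A)
    = ract M ∘ (idm M ⊗ₘ mul A) ∘ assocV M A A.
  by rewrite -ract_mul -[RHS]compA eqmK compm1.
rewrite /f !tensm_compl !compA ractV.
rewrite -(compA _ (lunitV A)) -tensm_l1V compA.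
rewrite -(compA _ (u ⊗ₘ idm A)) tensm_exch !compA.
rewrite -(compA _ (assocV M A A)) -tensmAV tensm1 -!compA.
congr (_ ∘ (_ ∘ (_ ∘ _))).
by rewrite /assocV /lunitV eqm_1tens eqm_comp; apply: eqm_irr.
Qed.

(** A linear morphism is determined by its value at the unit: [x f(1) = f(x 1)]. *)
Lemma lact_eval (C : strictMonoidal) (A : algebra C) (M : bimodule A)
    (f : hom A M) :
  f ∘ mul A = lact M ∘ (idm A ⊗ₘ f) ->
  lact M ∘ (idm A ⊗ₘ (f ∘ one A)) ∘ runitV A = f.
Proof.
move=> fl; rewrite tensm_compr compA -fl -!compA (compA (mul A)) mul_1r.
exact: compm1.
Qed.

Lemma ract_eval (C : strictMonoidal) (A : algebra C) (M : bimodule A)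
    (f : hom A M) :
  f ∘ mul A = ract M ∘ (f ⊗ₘ idm A) ->
  ract M ∘ ((f ∘ one A) ⊗ₘ idm A) ∘ lunitV A = f.
Proof.
move=> fr; rewrite tensm_compl compA -fr -!compA (compA (mul A)) mul_1l.
exact: compm1.
Qed.

Section Tensor.
Variables (C : strictMonoidal) (A : algebra C).

(** The left action touches only the first factor, where [f] is linear; the right action touches
    only the second, so it commutes with [f]. *)
Lemma tens_id_bilinear (f : hom A A) :
  f ∘ mul A = mul A ∘ (idm A ⊗ₘ f) ->
  (f ⊗ₘ idm A) ∘ tensor_lact A = tensor_lact A ∘ (idm A ⊗ₘ (f ⊗ₘ idm A)) /\
  (f ⊗ₘ idm A) ∘ tensor_ract A = tensor_ract A ∘ ((f ⊗ₘ idm A) ⊗ₘ idm A).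
Proof.
move=> fl; split; rewrite /tensor_lact /tensor_ract.
  by rewrite -(compA (mul A ⊗ₘ _)) -tensmA !compA -!tensm_compl fl.
rewrite -(compA (idm A ⊗ₘ mul A)) -tensmAV !compA tensm1.
by rewrite tensm_exch.
Qed.

(** Contracting the second factor by any [nu] leaves the left action on the first undisturbed. *)
Lemma id_tens_linear (nu : hom A 𝟙) (f := runit A ∘ (idm A ⊗ₘ nu)) :
  f ∘ tensor_lact A = mul A ∘ (idm A ⊗ₘ f).
Proof.
rewrite /f /tensor_lact tensm_compr !compA.
rewrite -(compA (runit A)) -tensm_exch !compA -tensm_r1.
rewrite -(tensm1 A A) -!compA tensmA.
congr (_ ∘ _); rewrite !compA; congr (_ ∘ _).
by rewrite /runit /assoc eqm_tens1 eqm_comp; apply: eqm_irr.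
Qed.

Lemma tens_id_linear (nu : hom A 𝟙) (f := lunit A ∘ (nu ⊗ₘ idm A)) :
  f ∘ tensor_ract A = mul A ∘ (f ⊗ₘ idm A).
Proof.
rewrite /f /tensor_ract tensm_compl !compA.
rewrite -(compA (lunit A)) tensm_exch !compA -tensm_l1.
rewrite -(tensm1 A A) -!compA tensmAV.
congr (_ ∘ _); rewrite !compA; congr (_ ∘ _).
by rewrite /lunit /assocV eqm_1tens eqm_comp; apply: eqm_irr.
Qed.

Lemma mul_tensor_lact :
  mul A ∘ tensor_lact A = mul A ∘ (idm A ⊗ₘ mul A).
Proof. by rewrite /tensor_lact compA mul_assoc. Qed.

End Tensor.

(** For [u = x ⊗ y] and [v = z ⊗ w], both sides are [x f(y, z) w]: the order in which [u] and [v]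
    are inserted is immaterial. *)
Lemma contract_interchange (C : strictMonoidal) (X Y Z W : C)
    (f : hom (Y ⊗ Z) 𝟙) (u : hom 𝟙 (X ⊗ Y)) (v : hom 𝟙 (Z ⊗ W)) :
  ((runit X ∘ (idm X ⊗ₘ f) ∘ assocV X Y Z ∘ (u ⊗ₘ idm Z) ∘ lunitV Z)
     ⊗ₘ idm W) ∘ v =
  (idm X ⊗ₘ (lunit W ∘ (f ⊗ₘ idm W) ∘ assoc Y Z W ∘ (idm Y ⊗ₘ v)
     ∘ runitV Y)) ∘ u.
Proof.
have uE : ((u ⊗ₘ idm Z) ∘ lunitV Z) ⊗ₘ idm W
    = assoc (X ⊗ Y) Z W ∘ (u ⊗ₘ idm (Z ⊗ W)) ∘ lunitV (Z ⊗ W).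
  rewrite tensm_compl -(tensm1 Z W) -tensmA -!compA; congr (_ ∘ _).
  by rewrite /lunitV eqm_1tens eqm_comp; apply: eqm_irr.
have vE : idm X ⊗ₘ ((idm Y ⊗ₘ v) ∘ runitV Y)
    = assocV X Y (Z ⊗ W) ∘ (idm (X ⊗ Y) ⊗ₘ v) ∘ runitV (X ⊗ Y).
  rewrite tensm_compr -(tensm1 X Y) -tensmAV -!compA; congr (_ ∘ _).
  by rewrite /runitV /assocV eqm_tens1 eqm_comp; apply: eqm_irr.
have fE : (runit X ⊗ₘ idm W) ∘ ((idm X ⊗ₘ f) ⊗ₘ idm W)
    = (idm X ⊗ₘ lunit W) ∘ (idm X ⊗ₘ (f ⊗ₘ idm W)) ∘ assocV X (Y ⊗ Z) W.
  rewrite -[RHS]compA tensmAV compA; congr (_ ∘ _).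
  rewrite /runit /lunit /assocV eqm_1tens eqm_tens1 eqm_comp; exact: eqm_irr.
(* The interchange law gives [u ⊗ v] on [𝟙 ⊗ 𝟙]; the left and right identifications of [𝟙 ⊗ 𝟙] with
   [𝟙] agree. *)
have uv : (u ⊗ₘ idm (Z ⊗ W)) ∘ (lunitV (Z ⊗ W) ∘ v)
    = (idm (X ⊗ Y) ⊗ₘ v) ∘ (runitV (X ⊗ Y) ∘ u).
  rewrite -tensm_l1V -tensm_r1V !compA -tensm_exch -!compA.
  by congr (_ ∘ (_ ∘ _)); apply: eqm_irr.
rewrite -(compA _ _ (lunitV Z)) -(compA _ _ (runitV Y)).
rewrite (tensm_compl _ _ ((u ⊗ₘ _) ∘ _)) (tensm_compr _ _ ((_ ⊗ₘ v) ∘ _)) uE vE.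
rewrite !tensm_compl !tensm_compr fE.
rewrite -!compA uv !compA; do 3 congr (_ ∘ _).
rewrite -!compA; do 2 congr (_ ∘ _).
rewrite /assoc /assocV eqm_1tens eqm_tens1 !eqm_comp; exact: eqm_irr.
Qed.

(** Since [x e1 ⊗ e2 = e1 ⊗ e2 x], one has [nu(x e1) e2 = nu(e1) e2 x = 1 x]. *)
Lemma frobenius_zigzag (C : strictMonoidal) (A : algebra C)
    (nu : hom A 𝟙) (e : hom 𝟙 (A ⊗ A)) :
  frobenius_pair nu e ->
  lunit A ∘ ((nu ∘ mul A) ⊗ₘ idm A) ∘ assoc A A A ∘ (idm A ⊗ₘ e) ∘ runitV A
  = idm A.
Proof.
case=> casimir nul _.
transitivity ((lunit A ∘ (nu ⊗ₘ idm A)) ∘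
    ((mul A ⊗ₘ idm A) ∘ assoc A A A ∘ (idm A ⊗ₘ e) ∘ runitV A)).
  by rewrite tensm_compl !compA.
rewrite casimir -/(tensor_ract A) 2!compA tens_id_linear.
by rewrite -(compA (mul A)) -tensm_compl nul mul_1l.
Qed.

(* With A ⊗ 𝟙 and A identified, Id ⊗ alpha ⊗ Id is a morphism from A ⊗ A to
   A ⊗ A ⊗ A: this is ((Id ⊗ alpha) ∘ runitV A) ⊗ Id below. *)
Theorem proposition4p9 (C : strictMonoidal) (A : algebra C)
    (frobA : frobenius A) (nu : hom A 𝟙) (e : hom 𝟙 (A ⊗ A))
    (nu_e : frobenius_pair nu e) :
  separable A <->
  exists alpha : hom 𝟙 A,
    mul A ∘ (mul A ⊗ₘ idm A) ∘ ((idm A ⊗ₘ alpha) ⊗ₘ idm A) ∘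
      (runitV A ⊗ₘ idm A) ∘ e = one A.
Proof.
have [casimir _ _] := nu_e.
have alphaE alpha : mul A ∘ (mul A ⊗ₘ idm A) ∘ ((idm A ⊗ₘ alpha) ⊗ₘ idm A) ∘
      (runitV A ⊗ₘ idm A) ∘ e
    = mul A ∘ (((mul A ∘ (idm A ⊗ₘ alpha) ∘ runitV A) ⊗ₘ idm A) ∘ e).
  by rewrite !tensm_compl !compA.
split=> [[gamma [[gl gr] mg]]|[alpha mae]].
  rewrite /= in gamma gl gr mg.
  pose phi := runit A ∘ (idm A ⊗ₘ nu).
  exists (phi ∘ gamma ∘ one A); rewrite alphaE.
  have pgl : (phi ∘ gamma) ∘ mul A = mul A ∘ (idm A ⊗ₘ (phi ∘ gamma)).
    rewrite tensm_compr compA -id_tens_linear -[LHS]compA -[RHS]compA.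
    by congr (_ ∘ _); exact: gl.
  (* Left linearity turns [x alpha] into [phi (gamma x)]. *)
  rewrite (@lact_eval C A (regular_bimodule A) (phi ∘ gamma) pgl).
  have gammaE := @ract_eval C A (tensor_bimodule A) gamma gr.
  (* Right linearity gives [gamma x = gamma(1) x], hence [phi (gamma x) = a nu(b x)]. *)
  have -> : phi ∘ gamma = runit A ∘ (idm A ⊗ₘ (nu ∘ mul A)) ∘ assocV A A A
      ∘ ((gamma ∘ one A) ⊗ₘ idm A) ∘ lunitV A.
    by rewrite -{1}gammaE /= /tensor_ract tensm_compr !compA.
  (* After the interchange the zigzag acts on [b] alone, as the identity. *)
  rewrite contract_interchange (frobenius_zigzag _ _ _ _ nu_e) tensm1 comp1m.
  by rewrite compA mg comp1m.
rewrite alphaE in mae.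
set beta := mul A ∘ _ ∘ _ in mae.
have bl : beta ∘ mul A = mul A ∘ (idm A ⊗ₘ beta).
  exact: (@lact_linear C A (regular_bimodule A) alpha).
have [bl2 br2] := tens_id_bilinear _ _ beta bl.
(* [c] is [x |-> x e]. By [casimir] it is also [x |-> e x], so it is linear on both sides. *)
pose c := tensor_lact A ∘ (idm A ⊗ₘ e) ∘ runitV A.
have cl : c ∘ mul A = tensor_lact A ∘ (idm A ⊗ₘ c).
  exact: (@lact_linear C A (tensor_bimodule A) e).
have cr : c ∘ mul A = tensor_ract A ∘ (c ⊗ₘ idm A).
  have -> : c = tensor_ract A ∘ (e ⊗ₘ idm A) ∘ lunitV A by [].
  exact: (@ract_linear C A (tensor_bimodule A) e).
exists ((beta ⊗ₘ idm A) ∘ c); split; first split=> /=.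
- by rewrite -compA cl tensm_compr (compA _ (tensor_lact A)) bl2 -compA.
- by rewrite -compA cr tensm_compl (compA _ (tensor_ract A)) br2 -compA.
(* Linearity pulls [x] out in front: the composite sends [x] to [x (e1 alpha e2)], which is [x 1] by
   [mae]. *)
rewrite /c 2!(compA (beta ⊗ₘ _)) bl2 2!(compA (mul A)) compA mul_tensor_lact.
by rewrite -[RHS](mul_1r A) -mae !tensm_compr !compA.
Qed.
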